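(* Let $T$ be a standard Young tableau of shape $\lambda\vdash k$. Then for $n\ge k$, the number of standard Young tableaux with $n$ cells (of any shape) that contain $T$ as a subtableau, i.e., in which the cells with entries $1,\ldots,k$ form exactly $T$, equals $$\sum_{j=0}^{k}\sum_{\mu\vdash j}f^{\lambda/\mu}\binom{n-k}{k-j}t_{n-2k+j}.$$
   Context: $f^{\lambda/\mu}$ is the number of standard Young tableaux of skew shape $\lambda/\mu$ (zero if $\mu\not\subseteq\lambda$), with $f^{\lambda/\emptyset}=f^\lambda$. $t_m$ denotes the number of involutions in $\mathcal{S}_m$ ($t_0=1$), and terms with $k-j>n-k$ are $0$. *)

(* Defs.v *)
From mathcomp Require Import all_boot all_order all_fingroup.
Set Implicit Arguments. Unset Strict Implicit. Unset Printing Implicit Defensive.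

Definition is_partition (l : seq nat) : bool :=
  sorted geq l && all (fun x => 0 < x) l.

Definition inS (l : seq nat) (i j : nat) : bool := j < nth 0 l i.

Definition subpart (mu lam : seq nat) : bool :=
  all (fun i => nth 0 mu i <= nth 0 lam i) (iota 0 (size mu)).

Definition skew (lam mu : seq nat) (i j : nat) : bool := inS lam i j && ~~ inS mu i j.

(* A filling of the N x N grid by values in {0,..,N}; 0 means "empty cell".
   skew_syt N lam mu S: S is a standard Young tableau of skew shape lam/mu
   (entries 1..|lam|-|mu|, each used once, rows and columns strictly increasing). *)
Definition skew_syt (N : nat) (lam mu : seq nat)
  (S : {ffun 'I_N * 'I_N -> 'I_N.+1}) : bool :=
  let m := sumn lam - sumn mu in
  [&& [forall i : 'I_N, forall j : 'I_N, (S (i, j) != 0 :> nat) == skew lam mu i j],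
      [forall i : 'I_N, forall j : 'I_N, skew lam mu i j ==> (S (i, j) <= m)],
      [forall i : 'I_N, forall j : 'I_N, forall i' : 'I_N, forall j' : 'I_N,
         [&& skew lam mu i j, skew lam mu i' j' & (S (i, j) == S (i', j') :> nat)]
           ==> ((i == i') && (j == j'))],
      [forall i : 'I_N, forall j : 'I_N, forall j' : 'I_N,
         [&& skew lam mu i j, skew lam mu i j' & j < j'] ==> (S (i, j) < S (i, j'))] &
      [forall i : 'I_N, forall i' : 'I_N, forall j : 'I_N,
         [&& skew lam mu i j, skew lam mu i' j & i < i'] ==> (S (i, j) < S (i', j))]].

(* f^{lam/mu}: number of standard Young tableaux of skew shape lam/mu
   (0 if mu is not contained in lam).  All cells of lam fit in the
   |lam| x |lam| grid when lam is a partition. *)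
Definition fskew (lam mu : seq nat) : nat :=
  if subpart mu lam then
    #|[set S : {ffun 'I_(sumn lam) * 'I_(sumn lam) -> 'I_(sumn lam).+1}
         | skew_syt lam mu S]|
  else 0.

Definition shape_of (n : nat) (S : {ffun 'I_n * 'I_n -> 'I_n.+1}) : seq nat :=
  filter (fun x => 0 < x)
    (map (fun i : 'I_n => #|[pred j : 'I_n | S (i, j) != 0 :> nat]|) (enum 'I_n)).

Definition is_syt (n : nat) (S : {ffun 'I_n * 'I_n -> 'I_n.+1}) : bool :=
  [&& is_partition (shape_of S), sumn (shape_of S) == n & skew_syt (shape_of S) [::] S].

Definition ext (N : nat) (S : {ffun 'I_N * 'I_N -> 'I_N.+1}) (i j : nat) : nat :=
  match (insub i : option 'I_N), (insub j : option 'I_N) with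
  | Some i', Some j' => val (S (i', j'))
  | _, _ => 0
  end.

Definition contains (k : nat) (T : {ffun 'I_k * 'I_k -> 'I_k.+1})
  (n : nat) (S : {ffun 'I_n * 'I_n -> 'I_n.+1}) : bool :=
  [forall i : 'I_n, forall j : 'I_n,
     if val (S (i, j)) <= k then val (S (i, j)) == ext T i j
     else ext T i j == 0].

(* Partitions of j are encoded (bijectively) as nonincreasing functions
   'I_j -> {0..j} summing to j; ffpart drops the zero parts. *)
Definition is_ffpart (j : nat) (mu : {ffun 'I_j -> 'I_j.+1}) : bool :=
  [forall a : 'I_j, forall b : 'I_j, (a <= b) ==> (mu b <= mu a)]
  && (\sum_(i < j) val (mu i) == j).

Definition ffpart (j : nat) (mu : {ffun 'I_j -> 'I_j.+1}) : seq nat :=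
  filter (fun x => 0 < x) (map (fun i : 'I_j => val (mu i)) (enum 'I_j)).

Definition tinv (m : nat) : nat := #|[set s : 'S_m | (s * s)%g == 1%g]|.

(* Main.v *)
Require Import Defs.
From mathcomp Require Import all_boot all_order all_fingroup zify.
Set Implicit Arguments. Unset Strict Implicit. Unset Printing Implicit Defensive.

(* Identify shapes with down-closed sets of cells and standard fillings of a
   skew shape with saturated chains in Young's lattice, via removal of the cell
   with the largest entry.  Write U and D for adding and removing a cell, and s
   for the linear functional equal to 1 on every shape.  Then DU - UD = 1 and
   s U = s D + s, hence s D^i U = s D^(i+1) + s D^i + i s D^(i-1), and by
   induction on m, using t_(m+1) = t_m + m t_(m-1),
     s U^m = sum_i 'C(m, i) t_(m-i) s D^i.
   At lambda with m = n - k, the left-hand side counts the tableaux containing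
   T, and s D^i lambda is the sum of f^(lambda/mu) over |mu| = k - i. *)

(** * Involutions *)

(** The relation DU - UD = 1 holds for all Young diagrams but breaks in a finite grid, for instance
    at a diagram with a full row. Growing to [n] cells only adds cells to diagrams with fewer than
    [n] of them, and in the [n] x [n] grid these leave the bottom row and the last column empty;
    hence the size bounds carried by the hypotheses. Only the diagonal part of the relation, one
    more addable than removable cell, is special to diagrams. The off-diagonal terms cancel because
    unions and intersections of down-closed sets are down-closed, so the algebra is done for a
    general finite relation. The index i is the number of removed cells: j = k - i, and t_(m-i) is
    t_(n-2k+j). The terms declared to be 0 are those whose binomial vanishes. *)

Section Involutions.
Variable T : finType.
Implicit Types (A : {set T}) (s : {perm T}) (x y : T).

(** The recursion for involutions discards one or two points. Permutations of a fixed type that move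
    only points of [A] allow this without maps between symmetric groups. *)
Definition involutions_on A : {set {perm T}} :=
  [set s | perm_on A s & (s * s == 1)%g].

Lemma involutions_onP A s :
  reflect (perm_on A s /\ involutive s) (s \in involutions_on A).
Proof.
rewrite inE; apply: (iffP andP) => -[sA ss]; split=> //.
  by move=> x; rewrite -permM (eqP ss) perm1.
by apply/eqP/permP => x; rewrite permM perm1 ss.
Qed.

Lemma involutions_on_fix A x :
  [set s in involutions_on A | s x == x] = involutions_on (A :\ x).
Proof.
apply/setP => s; rewrite in_set; apply/andP/involutions_onP.
  case=> /involutions_onP[/subsetP sA ss] /eqP sx; split=> //.
  apply/subsetP => y sy; rewrite !inE (sA _ sy) andbT.
  by apply: contraNneq sy => ->; rewrite sx.
case=> sA ss; split; last by rewrite (out_perm sA) // !inE eqxx.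
apply/involutions_onP; split=> //.
by apply: subset_trans sA (subsetDl _ _).
Qed.

(** Multiplication by [tperm x y] strips the 2-cycle on [x] and [y], and the same multiplication
    restores it. *)
Lemma card_involutions_on_swap A x y : x \in A -> y \in A -> x != y ->
  #|[set s in involutions_on A | s x == y]| = #|involutions_on (A :\ x :\ y)|.
Proof.
move=> xA yA xy.
rewrite -(card_imset _ (mulIg (tperm x y))); apply: eq_card => r.
apply/imsetP/involutions_onP.
  case=> s; rewrite in_set => /andP[/involutions_onP[sA ss] /eqP sx] ->.
  have sy : s y = x by rewrite -sx ss.
  split.
    apply/subsetP => z; rewrite !inE permM.
    have [->|zy] := eqVneq z y; first by rewrite sy tpermL eqxx.
    have [->|zx] := eqVneq z x; first by rewrite sx tpermR eqxx.
    rewrite tpermD; last 2 first.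
    - by apply: contraNneq zy; rewrite -{1}sy => /perm_inj ->.
    - by apply: contraNneq zx; rewrite -{1}sx => /perm_inj ->.
    by move=> sz /=; apply: (subsetP sA); rewrite inE.
  move=> z; rewrite !permM.
  have [->|zy] := eqVneq z y; first by rewrite sy tpermL sy tpermL.
  have [->|zx] := eqVneq z x; first by rewrite sx tpermR sx tpermR.
  have sz1 : x != s z by apply: contraNneq zy; rewrite -{1}sy => /perm_inj ->.
  have sz2 : y != s z by apply: contraNneq zx; rewrite -{1}sx => /perm_inj ->.
  by rewrite [tperm x y (s z)]tpermD // ss tpermD // eq_sym.
case=> rA rr; exists (r * tperm x y)%g; last by rewrite -mulgA tperm2 mulg1.
have rx : r x = x by rewrite (out_perm rA) // !inE eqxx andbF.
have ry : r y = y by rewrite (out_perm rA) // !inE eqxx.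
rewrite in_set; apply/andP; split; last by rewrite permM rx tpermL.
apply/involutions_onP; split.
  apply/subsetP => z; rewrite !inE permM.
  have [->//|zy] := eqVneq z y.
  have [->//|zx] := eqVneq z x.
  case: (tpermP x y (r z)) => [e|e|_ _].
  - by case/eqP: zx; apply: (@perm_inj _ r); rewrite e rx.
  - by case/eqP: zy; apply: (@perm_inj _ r); rewrite e ry.
  by move=> rz; have:= subsetP rA z; rewrite !inE zx zy => /(_ rz).
move=> z; rewrite !permM.
have [->|zy] := eqVneq z y; first by rewrite ry tpermR rx tpermL.
have [->|zx] := eqVneq z x; first by rewrite rx tpermL ry tpermR.
have sz1 : x != r z by apply: contraNneq zx; rewrite -{1}rx => /perm_inj ->.
have sz2 : y != r z by apply: contraNneq zy; rewrite -{1}ry => /perm_inj ->.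
by rewrite [tperm x y (r z)]tpermD // rr tpermD // eq_sym.
Qed.

Lemma card_involutions_onD1 A x : x \in A ->
  #|involutions_on A| = #|involutions_on (A :\ x)|
    + \sum_(y in A :\ x) #|involutions_on (A :\ x :\ y)|.
Proof.
move=> xA; rewrite -sum1_card (partition_big (fun s : {perm T} => s x) (mem A)) /=.
  rewrite (bigD1 x) //=; congr (_ + _).
    by rewrite -involutions_on_fix -sum1_card; apply: eq_bigl => s; rewrite [RHS]inE.
  apply: eq_big => [y|y /andP[yA yx]]; first by rewrite !inE andbC.
  rewrite -card_involutions_on_swap // 1?eq_sym // -sum1_card.
  by apply: eq_bigl => s; rewrite [RHS]inE.
by move=> s /involutions_onP[sA _]; rewrite (perm_closed _ sA).
Qed.

End Involutions.

Lemma cardD1_pred (T : finType) (A : {set T}) x : x \in A -> #|A :\ x| = #|A|.-1.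
Proof. by move=> xA; rewrite (cardsD1 x A) xA. Qed.

(** Removing a point reduces both sides to sets smaller by one and by two, with a number of terms
    that depends on the cardinality alone; hence the induction on a bound for [#|A|]. *)
Lemma eq_card_involutions_on (T U : finType) (A : {set T}) (B : {set U}) :
  #|A| = #|B| -> #|involutions_on A| = #|involutions_on B|.
Proof.
move: {2}#|A| (leqnn #|A|) => m.
elim: m A B => [|m IH] A B leAm eAB.
  have A0 : A = set0 by apply/eqP; rewrite -cards_eq0; lia.
  have B0 : B = set0 by apply/eqP; rewrite -cards_eq0; lia.
  suff H (V : finType) : #|involutions_on (set0 : {set V})| = 1 by rewrite A0 B0 !H.
  rewrite -(cards1 (1%g : {perm V})); apply: eq_card => s; rewrite !inE.
  apply/andP/eqP => [[s0 _]|->]; last by rewrite perm_on1 mulg1 eqxx.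
  by apply/permP => x; rewrite perm1 (out_perm s0) // inE.
have [A0|[x xA]] := set_0Vmem A.
  by apply: IH; rewrite // A0 cards0.
have [B0|[y yB]] := set_0Vmem B.
  by move: eAB; rewrite B0 cards0 (cardsD1 x) xA.
have eD : #|A :\ x| = #|B :\ y| by move: eAB; rewrite (cardsD1 x) (cardsD1 y B) xA yB; lia.
have leD : #|A :\ x| <= m by move: leAm; rewrite (cardsD1 x) xA; lia.
rewrite (card_involutions_onD1 xA) (card_involutions_onD1 yB) (IH _ _ leD eD).
congr (_ + _).
have [A0|[x' x'A]] := set_0Vmem (A :\ x).
  have B0 : B :\ y = set0 by apply/eqP; rewrite -cards_eq0 -eD A0 cards0.
  by rewrite A0 B0 !big_set0.
have [B0|[y' y'B]] := set_0Vmem (B :\ y).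
  by move: eD; rewrite B0 cards0 (cardsD1 x') x'A.
transitivity (\sum_(z in A :\ x) #|involutions_on (B :\ y :\ y')|).
  apply: eq_bigr => z zA; apply: IH; first by rewrite cardD1_pred //; lia.
  by rewrite !cardD1_pred // eAB.
rewrite [RHS](eq_bigr (fun=> #|involutions_on (B :\ y :\ y')|)); last first.
  (* The induction hypothesis relates a subset of [T] to a subset of [U], so two subsets of [U] are
     compared through one of [T]. *)
  move=> z zB; transitivity #|involutions_on (A :\ x :\ x')|; last first.
    by apply: IH; rewrite ?cardD1_pred //; lia.
  by apply/esym/IH; rewrite ?cardD1_pred //; lia.
by rewrite !sum_nat_const eD.
Qed.

Lemma card_involutions_on (T : finType) (A : {set T}) : #|involutions_on A| = tinv #|A|.
Proof.
transitivity #|involutions_on [set: 'I_#|A|]|.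
  by apply: eq_card_involutions_on; rewrite cardsT card_ord.
apply: eq_card => s; rewrite !inE /perm_on.
by rewrite (_ : (_ \subset _) = true) //; apply/subsetP => x _; rewrite inE.
Qed.

Lemma tinvS m : tinv m.+1 = tinv m + m * tinv m.-1.
Proof.
have cT : #|[set: 'I_m.+1]| = m.+1 by rewrite cardsT card_ord.
rewrite -[in LHS]cT -card_involutions_on (@card_involutions_onD1 _ _ ord0) ?inE // card_involutions_on.
rewrite cardD1_pred ?inE // cT; congr (_ + _).
rewrite (eq_bigr (fun=> tinv m.-1)).
  by rewrite sum_nat_const cardD1_pred ?inE // cT.
by move=> y yT; rewrite card_involutions_on !cardD1_pred ?inE ?cT //; move: yT; rewrite !inE.
Qed.

Lemma tinv0 : tinv 0 = 1.
Proof.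
rewrite -(cards1 (1%g : 'S_0)); apply: eq_card => s; rewrite !inE.
have -> : s = 1%g by apply/permP => -[].
by rewrite mulg1 !eqxx.
Qed.

(** * Chains of ideals *)

(** Since (i+1) C(m, i+1) = (m-i) C(m, i), this is C(m, i) times the recursion for t_(m-i+1); for i
    > m everything vanishes. *)
Lemma binomial_tinvS m i :
  'C(m, i) * tinv (m - i) + i.+1 * ('C(m, i.+1) * tinv (m - i.+1))
  = 'C(m, i) * tinv (m.+1 - i).
Proof.
rewrite mulnA mul_bin_left; case: (leqP i m) => [leim|ltmi].
  by rewrite subSn // tinvS -subnS -mulnA mulnCA -mulnDr.
by rewrite bin_small // muln0.
Qed.

(* The coefficients of s U^(m+1) = sum_i 'C(m, i) t_(m-i) s D^i U, after
   rewriting s D^i U = s D^(i+1) + s D^i + i s D^(i-1). *)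
Lemma binomial_tinv_sum (f : nat -> nat) m K : m.+1 < K ->
  \sum_(i < K) 'C(m, i) * tinv (m - i) * (f i.+1 + f i + i * f i.-1)
  = \sum_(i < K) 'C(m.+1, i) * tinv (m.+1 - i) * f i.
Proof.
case: K => // K; rewrite ltnS => ltmK.
pose a i := 'C(m, i) * tinv (m - i).
have a0 i : m < i -> a i = 0 by move=> ltmi; rewrite /a bin_small.
(* The third sum is shifted so that it carries [f i]; the boundary terms vanish because [m < K]. *)
transitivity (\sum_(i < K) a i * f i.+1 + \sum_(i < K.+1) a i * f i
              + \sum_(i < K.+1) i.+1 * a i.+1 * f i).
  rewrite (eq_bigr (fun i : 'I_K.+1 => a i * f i.+1 + a i * f i + i * a i * f i.-1)).
    rewrite !big_split /=; congr (_ + _ + _).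
      by rewrite big_ord_recr /= a0 // mul0n addn0.
    rewrite big_ord_recl big_ord_recr /= [a K.+1]a0 ?muln0 ?addn0; last by lia.
    by rewrite !mul0n.
  by move=> i _; rewrite !mulnDr mulnA [_ * i]mulnC.
(* The last two sums merge by [binomial_tinvS]; Pascal's rule then absorbs the first one. *)
rewrite -addnA -big_split /= (eq_bigr (fun i : 'I_K.+1 => 'C(m, i) * tinv (m.+1 - i) * f i)).
  rewrite [RHS]big_ord_recl big_ord_recl /= addnCA !bin0 -big_split; congr (_ + _).
  apply: eq_bigr => i _; rewrite /a /= /bump /= !add1n binS subSS; lia.
by move=> i _; rewrite -mulnDl -binomial_tinvS.
Qed.

Section Chains.
Variables (P : finType) (le : rel P).
Implicit Types (D M : {set P}) (c d : P).

Definition ideal D : bool :=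
  [forall c in D, forall d, le d c ==> (d \in D)].

Lemma idealP D :
  reflect (forall c d, c \in D -> le d c -> d \in D) (ideal D).
Proof.
apply: (iffP 'forall_in_forallP) => [iD c d cD|iD c cD d].
  by have /implyP := iD c cD d.
by apply/implyP; apply: iD.
Qed.

Lemma idealI D M : ideal D -> ideal M -> ideal (D :&: M).
Proof.
move=> /idealP iD /idealP iM; apply/idealP => c d /setIP[cD cM] dc.
by apply/setIP; split; [apply: iD cD dc | apply: iM cM dc].
Qed.

Lemma idealU D M : ideal D -> ideal M -> ideal (D :|: M).
Proof.
move=> /idealP iD /idealP iM; apply/idealP => c d /setUP[cD|cM] dc.
  by apply/setUP; left; apply: iD cD dc.
by apply/setUP; right; apply: iM cM dc.
Qed.

Definition removable D c := (c \in D) && ideal (D :\ c).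
Definition addable D c := (c \notin D) && ideal (c |: D).

(** For diagrams this is f^(D/M), the cells being removed in decreasing order of their entries.
    Below, [down_chains i] is the functional s D^i and [up_chains i] is s U^i. *)
Fixpoint chains M i D : nat :=
  if i is i'.+1 then \sum_(c | removable D c) chains M i' (D :\ c)
  else D == M.

Fixpoint down_chains i D : nat :=
  if i is i'.+1 then \sum_(c | removable D c) down_chains i' (D :\ c) else 1.

Fixpoint up_chains i D : nat :=
  if i is i'.+1 then \sum_(c | addable D c) up_chains i' (c |: D) else 1.

Lemma chains_eq0 M i D :
  ~~ ((M \subset D) && (#|D| == #|M| + i)) -> chains M i D = 0.
Proof.
elim: i D => [|i IH] D /=.
  by case: (D =P M) => // ->; rewrite subxx addn0 eqxx.
move=> nMD; apply: big1 => c /andP[cD _]; apply: IH; apply: contra nMD.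
move=> /andP[MD cM]; rewrite (subset_trans MD) ?subsetDl //=.
by rewrite (cardsD1 c) cD (eqP cM) addnS.
Qed.

(** The definition splits a chain at its top step; this splits it at the bottom step, which is what
    sums over the upper end [D] require. *)
Lemma chainsS M i D : ideal M -> ideal D ->
  chains M i.+1 D = \sum_(c | addable M c) chains (c |: M) i D.
Proof.
move=> iM; elim: i D => [|i IH] D iD.
  rewrite /= [LHS]big_mkcond [RHS]big_mkcond; apply: eq_bigr => c _.
  rewrite /removable /addable.
  have [cD|cD] /= := boolP (c \in D); last first.
    case: ifP => // /andP[cM _]; case: eqP => // DE.
    by rewrite DE setU11 in cD.
  case: (D :\ c =P M) => [DM|DM].
    by rewrite DM iM -DM setD11 setD1K // iD eqxx.
  rewrite if_same; case: ifP => // /andP[cM _]; case: eqP => // DE.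
  by case: DM; rewrite DE setU1K.
rewrite [LHS]/=.
rewrite (eq_bigr (fun d => \sum_(c | addable M c) chains (c |: M) i (D :\ d))).
  exact: exchange_big.
by move=> d /andP[_ iDd]; apply: IH.
Qed.

Lemma down_chainsE i D : ideal D ->
  down_chains i D = \sum_(M | ideal M) chains M i D.
Proof.
elim: i D => [|i IH] D iD /=.
  rewrite (bigD1 D) //= eqxx big1 // => M /andP[_ /negPf].
  by rewrite eq_sym => ->.
rewrite exchange_big /=; apply: eq_bigr => c /andP[_ iDc]; exact: IH.
Qed.

Lemma up_chainsE i M : ideal M ->
  up_chains i M = \sum_(D | ideal D) chains M i D.
Proof.
elim: i M => [|i IH] M iM.
  by rewrite /= (bigD1 M) //= eqxx big1 // => D /andP[_ /negPf ->].
rewrite (eq_bigr _ (fun D iD => chainsS i iM iD)) exchange_big /=.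
by apply: eq_bigr => c /andP[_ iMc]; apply: IH.
Qed.

(* Away from the diagonal, removing [d] commutes with adding [c]; only the
   diagonal terms of DU and UD differ. *)
Lemma down_up_swap (F : {set P} -> nat) D : ideal D ->
  \sum_(c | addable D c) \sum_(d | removable (c |: D) d) F ((c |: D) :\ d)
    + #|[set d | removable D d]| * F D
  = \sum_(d | removable D d) \sum_(c | addable (D :\ d) c) F (c |: (D :\ d))
    + #|[set c | addable D c]| * F D.
Proof.
move=> iD.
have card1 (p : pred P) : #|[set c | p c]| * F D = \sum_(c | p c) F D.
  by rewrite sum_nat_const; congr (_ * _); apply: eq_card => c; rewrite inE.
rewrite !card1.
rewrite (_ : \sum_(c | addable D c) \sum_(d | removable (c |: D) d) _ =
    \sum_(c | addable D c) F D + \sum_(c | addable D c)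
      \sum_(d | removable (c |: D) d && (d != c)) F ((c |: D) :\ d)); last first.
  rewrite -big_split /=; apply: eq_bigr => c /andP[cD icD].
  by rewrite (bigD1 c) /= ?setU1K // /removable setU11 setU1K.
rewrite (_ : \sum_(d | removable D d) \sum_(c | addable (D :\ d) c) _ =
    \sum_(d | removable D d) F D + \sum_(d | removable D d)
      \sum_(c | addable (D :\ d) c && (c != d)) F (c |: (D :\ d))); last first.
  rewrite -big_split /=; apply: eq_bigr => d /andP[dD idD].
  by rewrite (bigD1 d) /= ?setD1K // /addable setD11 setD1K.
rewrite -!addnA addnCA [RHS]addnCA; congr (_ + _); last exact: addnC.
have DcdE c d : d != c -> (c |: D) :\ d = c |: (D :\ d).
  by move=> dc; rewrite setDUl; congr (_ :|: _); apply/setDidPl; rewrite disjoints1 inE eq_sym.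
(* For [d != c] the conditions on both sides agree: [c |: D] is the union of [D] and
   [c |: (D :\ d)], and [D :\ d] is the intersection of [D] and [(c |: D) :\ d]. *)
rewrite (exchange_big_dep (removable D)) /=.
  apply: eq_bigr => d /andP[dD iDd]; apply: eq_big => [c|c /and3P[_ _ dc]]; last by rewrite DcdE.
  rewrite eq_sym; have [|dc] := eqVneq c d; first by rewrite !andbF.
  rewrite !andbT /addable /removable !inE dc dD orbT /= DcdE 1?eq_sym //.
  case: (boolP (c \in D)) => cD //=; apply: andb_idl => icD.
  suff -> : c |: D = D :|: (c |: (D :\ d)) by rewrite idealU.
  by apply/setP => x; rewrite !inE; case: (x \in D); rewrite ?andbF ?orbT ?orbF.
move=> c d /andP[cD icD] /andP[/andP[dcD iDd] dc].
have dD : d \in D by move: dcD; rewrite !inE (negPf dc).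
rewrite /removable dD.
suff -> : D :\ d = D :&: ((c |: D) :\ d) by rewrite idealI.
by apply/setP => x; rewrite !inE; case: (x \in D); rewrite ?andbF ?orbT ?andbT.
Qed.

(** U is moved past the i copies of D one at a time, and each exchange leaves one term s D^(i-1).
    All exchanges take place at ideals contained in [D], so the count of cells is required only
    there. *)
Lemma down_chains_up D i : ideal D ->
  (forall M, ideal M -> M \subset D ->
     #|[set c | addable M c]| = #|[set d | removable M d]| + 1) ->
  \sum_(c | addable D c) down_chains i (c |: D)
    = down_chains i.+1 D + down_chains i D + i * down_chains i.-1 D.
Proof.
elim: i D => [|i IH] D iD rank.
  rewrite /= mul0n addn0 !sum1dep_card; exact: rank.
have := down_up_swap (down_chains i) iD.
(* The multiple of [down_chains i D] by the number of removable cells cancels, which leaves one copy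
   of it. *)
rewrite rank // mulnDl mul1n [RHS]addnCA addnC => /addnI ->.
rewrite (eq_bigr (fun d => down_chains i.+1 (D :\ d) + down_chains i (D :\ d)
   + i * down_chains i.-1 (D :\ d))); last first.
  move=> d /andP[_ iDd]; apply: IH => // M iM sMD; apply: rank => //.
  exact: subset_trans sMD (subsetDl _ _).
rewrite !big_split -big_distrr /=.
(* For [i = 0] the predecessor is truncated, but its coefficient is zero. *)
case: i {IH} => [|i] /=; first by rewrite !mul0n mul1n addn0.
by rewrite mulSn; lia.
Qed.

(** A free bound [K] above [m] keeps one range of summation throughout the induction; the terms with
    i > m have a zero binomial. The last of the [m] additions starts from [#|D| + m - 1] cells,
    hence the strict bound on [#|M|]. *)
Lemma up_chains_down_chains D m K : ideal D ->
  (forall M, ideal M -> #|M| < #|D| + m ->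
     #|[set c | addable M c]| = #|[set d | removable M d]| + 1) ->
  m < K ->
  up_chains m D = \sum_(i < K) 'C(m, i) * tinv (m - i) * down_chains i D.
Proof.
elim: m D K => [|m IH] D K iD rank ltmK.
  rewrite /= (bigD1 (Ordinal ltmK)) //= bin0 mul1n.
  rewrite big1 ?addn0; first by rewrite subn0 tinv0 mul1n.
  move=> [[|i] lti] //= _; rewrite bin0n; lia.
have rankD M : ideal M -> M \subset D ->
     #|[set c | addable M c]| = #|[set d | removable M d]| + 1.
  by move=> iM /subset_leq_card leMD; apply: rank => //; lia.
rewrite /= (eq_bigr (fun c => \sum_(i < K) 'C(m, i) * tinv (m - i) * down_chains i (c |: D))); last first.
  move=> c /andP[cD icD]; apply: IH => //; last by lia.
  by move=> M iM; rewrite cardsU1 cD => ltM; apply: rank => //; lia.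
rewrite exchange_big /=.
rewrite (eq_bigr (fun i : 'I_K => 'C(m, i) * tinv (m - i) *
   (down_chains i.+1 D + down_chains i D + i * down_chains i.-1 D))); last first.
  by move=> i _; rewrite -big_distrr /= down_chains_up.
exact: (binomial_tinv_sum (fun i => down_chains i D)).
Qed.

End Chains.

(** * Linear extensions *)

Section Fillings.
Variables (P : finType) (le : rel P) (N : nat) (B : {ffun P -> 'I_N.+1}).
Variables (M : {set P}) (k : nat).
Implicit Types (D : {set P}) (c d : P) (S : {ffun P -> 'I_N.+1}).

(* Linear extensions of [D :\: M] labelled by [k+1, .., k+i], extended by [B]
   on [M] and by [0] outside [D]. *)
Definition fillings i D : {set {ffun P -> 'I_N.+1}} :=
  [set S : {ffun P -> 'I_N.+1} | [&& [forall c in M, S c == B c],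
    [forall c, (c \notin D) ==> (S c == ord0)],
    [forall c in D :\: M, k < S c <= k + i],
    [forall c in D :\: M, forall d in D :\: M, (S c == S d) ==> (c == d)] &
    [forall c in D :\: M, forall d in D :\: M,
       le c d && (c != d) ==> (S c < S d)]]].

Lemma fillingsP i D S :
  reflect [/\ {in M, S =1 B}, forall c, c \notin D -> S c = ord0,
    {in D :\: M, forall c, k < S c <= k + i},
    {in D :\: M &, injective S} &
    {in D :\: M &, forall c d, le c d -> c != d -> S c < S d}]
  (S \in fillings i D).
Proof.
rewrite inE; apply: (iffP and5P) => -[h1 h2 h3 h4 h5]; split.
- by move=> c /(forall_inP h1)/eqP.
- by move=> c cD; apply/eqP; apply: (implyP (forallP h2 c)).
- exact/forall_inP.
- move=> c d cD dD /eqP Scd; apply/eqP.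
  exact: implyP (forall_inP (forall_inP h4 c cD) d dD) Scd.
- move=> c d cD dD cd ncd.
  by apply: (implyP (forall_inP (forall_inP h5 c cD) d dD)); rewrite cd.
- by apply/forall_inP => c /h1/eqP.
- by apply/forallP => c; apply/implyP => /h2/eqP.
- exact/forall_inP.
- apply/forall_inP => c cD; apply/forall_inP => d dD; apply/implyP => /eqP.
  by move/(h4 c d cD dD)/eqP.
- apply/forall_inP => c cD; apply/forall_inP => d dD; apply/implyP => /andP[].
  exact: h5.
Qed.

(** Pigeonhole: if the top label were missing, [i.+1] cells would carry distinct labels among the
    [i] values [k.+1 + x]. *)
Lemma fillings_top i D S : S \in fillings i.+1 D -> #|D :\: M| = i.+1 ->
  exists2 c, c \in D :\: M & S c = k + i.+1 :> nat.
Proof.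
move=> /fillingsP[_ _ h3 h4 _] cD.
case: (boolP [exists c in D :\: M, S c == k + i.+1 :> nat]).
  by case/exists_inP => c cDM /eqP; exists c.
rewrite negb_exists_in => /forall_inP nS.
suff : #|D :\: M| <= i by rewrite cD ltnn.
rewrite -(card_in_imset h4) -[leqRHS]card_ord.
apply: leq_trans (leq_imset_card (fun x : 'I_i => inord (k.+1 + x) : 'I_N.+1) predT).
apply/subset_leq_card/subsetP => v /imsetP[c cDM ->].
have := h3 c cDM; have := nS c cDM => ni /andP[lk li].
have lti : S c - k.+1 < i by lia.
apply/imsetP; exists (Ordinal lti) => //=; apply: val_inj.
by rewrite /= subnKC // inord_val.
Qed.

(** A further cell of [D] above [c] would either lie in the ideal [M], forcing [c] into [M], or
    carry a label beyond the largest one. *)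
Lemma removable_top i D S c : ideal le M -> ideal le D ->
  S \in fillings i.+1 D -> c \in D :\: M -> S c = k + i.+1 :> nat ->
  ideal le (D :\ c).
Proof.
move=> /idealP iM /idealP iD /fillingsP[_ _ h3 _ h5] cDM Sc.
apply/idealP => b a; rewrite !inE => /andP[bc bD] ab.
rewrite (iD b a bD ab) andbT; apply/eqP => ac; rewrite {}ac in ab.
have bM : b \notin M.
  by apply/negP => bM; move: cDM; rewrite inE (iM b c bM ab).
have bDM : b \in D :\: M by rewrite inE bM.
have := h3 b bDM; have := h5 c b cDM bDM ab; rewrite eq_sym bc Sc => /(_ isT).
by lia.
Qed.

(** Resetting the top label at [c] to 0 is inverse to writing it there; the bound by [N] makes
    [inord] faithful on this label. *)
Lemma card_fillings_top i D c : ideal le M -> c \in D -> c \notin M ->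
  ideal le (D :\ c) -> k + i.+1 <= N ->
  #|[set S in fillings i.+1 D | S c == k + i.+1 :> nat]| = #|fillings i (D :\ c)|.
Proof.
move=> /idealP iM cD cM /idealP iDc leN.
have topE : val (inord (k + i.+1) : 'I_N.+1) = k + i.+1 by rewrite /= inordK.
have DcE x : (x \in (D :\ c) :\: M) = (x != c) && (x \in D :\: M).
  by rewrite !inE; case: (x \in M); rewrite ?andbF.
pose upd (v : 'I_N.+1) S := [ffun x => if x == c then v else S x] : {ffun P -> 'I_N.+1}.
rewrite -[RHS](card_in_imset (f := upd (inord (k + i.+1)))); last first.
  move=> S1 S2 /fillingsP[_ z1 _ _ _] /fillingsP[_ z2 _ _ _] /ffunP e.
  apply/ffunP => x; have := e x; rewrite !ffunE; case: eqP => // -> _.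
  by rewrite z1 ?z2 ?setD11.
apply: eq_card => S; rewrite inE; apply/andP/imsetP.
  case=> /fillingsP[h1 h2 h3 h4 h5] /eqP Sc.
  have SE : S = upd (inord (k + i.+1)) (upd ord0 S).
    by apply/ffunP => x; rewrite !ffunE; case: eqP => // ->; apply/val_inj; rewrite topE.
  exists (upd ord0 S) => //; apply/fillingsP; split.
  - by move=> x xM; rewrite ffunE h1 //; case: eqP => // xc; rewrite -xc xM in cM.
  - move=> x; rewrite !inE ffunE; case: eqP => //= _; exact: h2.
  - move=> x; rewrite DcE ffunE => /andP[/negPf xc xDM]; rewrite xc.
    have /andP[-> /=] := h3 x xDM; rewrite leq_eqVlt addnS ltnS => /orP[|//].
    rewrite -addnS -Sc => /eqP/val_inj/h4 xe; move: xc; rewrite xe ?eqxx //.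
    by rewrite inE cM.
  - move=> x y; rewrite !DcE !ffunE => /andP[/negPf-> xDM] /andP[/negPf-> yDM].
    exact: h4.
  - move=> x y; rewrite !DcE !ffunE => /andP[/negPf-> xDM] /andP[/negPf-> yDM].
    exact: h5.
case=> S' /fillingsP[h1 h2 h3 h4 h5] ->; split; last by rewrite ffunE eqxx topE.
have xDc x : x \in D :\: M -> x != c -> x \in (D :\ c) :\: M by rewrite DcE => -> ->.
apply/fillingsP; split.
- by move=> x xM; rewrite ffunE h1 //; case: eqP => // xc; rewrite -xc xM in cM.
- move=> x xD; rewrite ffunE; case: eqP => [xc|_]; first by rewrite xc cD in xD.
  by apply: h2; rewrite inE negb_and xD orbT.
- move=> x xDM; rewrite ffunE; case: eqP => [_|/eqP xc]; first by rewrite topE; lia.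
  by have := h3 x (xDc x xDM xc); lia.
- move=> x y xDM yDM; rewrite !ffunE; case: eqP => [->|/eqP xc]; case: eqP => [->|/eqP yc] //.
  + by move/(congr1 val); rewrite topE => e; have := h3 y (xDc y yDM yc); rewrite -e; lia.
  + by move/(congr1 val); rewrite topE => e; have := h3 x (xDc x xDM xc); rewrite e; lia.
  by apply: h4; apply: xDc.
- move=> x y xDM yDM xy nxy; rewrite !ffunE.
  case: eqP => [xc|/eqP xc]; case: eqP => [yc|/eqP yc].
  + by rewrite xc yc eqxx in nxy.
  (* No other cell of [D] lies above [c], since [D :\ c] is an ideal. *)
  + have /iDc : y \in D :\ c by move: yDM; rewrite !inE yc => /andP[].
    by move=> /(_ x xy); rewrite xc setD11.
  + by rewrite topE; have := h3 x (xDc x xDM xc); lia.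
  by apply: h5 => //; apply: xDc.
Qed.

Theorem card_fillings i D : ideal le M -> ideal le D -> M \subset D ->
  #|D| = #|M| + i -> k + i <= N -> #|fillings i D| = chains le M i D.
Proof.
move=> iM; elim: i D => [|i IH] D iD sMD cD leN.
  have DM : D = M by apply/esym/eqP; rewrite eqEcard sMD cD addn0 leqnn.
  rewrite /= DM eqxx.
  rewrite -[RHS](cards1 ([ffun c => if c \in M then B c else ord0] : {ffun P -> 'I_N.+1})).
  apply: eq_card => S; rewrite [RHS]inE; apply/fillingsP/eqP => [[h1 h2 _ _ _]|->].
    by apply/ffunP => c; rewrite ffunE; case: ifPn => [/h1|/h2].
  split.
  - by move=> c cM; rewrite ffunE cM.
  - by move=> c /negPf cM; rewrite ffunE cM.
  - by move=> c; rewrite setDv inE.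
  - by move=> c d; rewrite setDv inE.
  - by move=> c d; rewrite setDv inE.
have cDM : #|D :\: M| = i.+1 by rewrite cardsD (setIidPr sMD) cD addKn.
(* Fillings are sorted by the unique cell that carries the top label. *)
transitivity (\sum_(c in D :\: M)
    #|[set S in fillings i.+1 D | S c == k + i.+1 :> nat]|).
  transitivity (\sum_(S in fillings i.+1 D)
      \sum_(c in D :\: M | S c == k + i.+1 :> nat) 1).
    rewrite -sum1_card; apply: eq_bigr => S SW.
    have [c cDM' Sc] := fillings_top SW cDM.
    rewrite (bigD1 c) /= ?cDM' ?Sc ?eqxx // big1 // => d /andP[/andP[dDM Sd] dc].
    case/fillingsP: SW => _ _ _ h4 _; case/eqP: dc; apply: h4 => //.
    by apply: val_inj; rewrite /= Sc (eqP Sd).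
  rewrite (exchange_big_dep (mem (D :\: M))) /=; last by move=> S c _ /andP[].
  apply: eq_bigr => c cDM'; rewrite -sum1_card; apply: eq_bigl => S.
  by rewrite [RHS]inE cDM'.
(* The two ranges differ, but the surplus terms vanish: after removing a cell of [M] no chain
   reaches [M], and a cell that is not removable never carries the top label. *)
rewrite /= big_mkcond [RHS]big_mkcond; apply: eq_bigr => c _.
rewrite inE /removable; case: (boolP (c \in M)) => cM /=.
  rewrite chains_eq0 ?if_same // negb_and; apply/orP; left.
  by apply/subsetPn; exists c; rewrite // setD11.
case: (boolP (c \in D)) => cD' //=; case: ifPn => iDc.
  rewrite card_fillings_top // IH //; last by lia.
    by apply/subsetD1P.
  by move: cD; rewrite (cardsD1 c) cD'; lia.
apply/eqP; rewrite cards_eq0 -subset0; apply/subsetP => S; rewrite inE => /andP[SW /eqP Sc].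
by case/negP: iDc; apply: removable_top SW _ Sc => //; rewrite inE cM.
Qed.

End Fillings.

Lemma down_chains_eq0 (P : finType) (le : rel P) i (D : {set P}) :
  #|D| < i -> down_chains le i D = 0.
Proof.
elim: i D => // i IH D ltDi; apply: big1 => c /andP[cD _]; apply: IH.
by move: ltDi; rewrite (cardsD1 c) cD.
Qed.

(** * Transport of chains along embeddings with down-closed image *)

Section Transfer.
Variables (P Q : finType) (leP : rel P) (leQ : rel Q) (f : P -> Q).
Hypothesis f_inj : injective f.
Hypothesis f_mono : {mono f : c d / leP c d >-> leQ c d}.
Hypothesis f_ideal : forall c d, leQ d (f c) -> d \in codom f.

Lemma ideal_imset (D : {set P}) : ideal leQ (f @: D) = ideal leP D.
Proof.
apply/idealP/idealP => iD.
  move=> c d cD dc; rewrite -(mem_imset _ _ f_inj).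
  by apply: (iD (f c)); rewrite ?imset_f ?f_mono.
move=> _ d /imsetP[c cD ->] dc; have /codomP[d' dE] := f_ideal dc.
by rewrite dE imset_f //; apply: (iD c); rewrite // -f_mono -dE.
Qed.

(** Removals never leave the image of [f], whereas an added cell could; hence only descending chains
    are transported. *)
Lemma down_chains_imset i (D : {set P}) : down_chains leQ i (f @: D) = down_chains leP i D.
Proof.
elim: i D => //= i IH D.
have fD1 c : f @: D :\ f c = f @: (D :\ c).
  apply/setP => x; apply/setD1P/imsetP => [[xc /imsetP[y yD xy]]|[y /setD1P[yc yD] ->]].
    by exists y => //; rewrite !inE yD andbT; apply: contraNneq xc => <-; rewrite xy.
  by rewrite imset_f // (inj_eq f_inj).
rewrite /removable [LHS]big_mkcondr [RHS]big_mkcondr /= big_imset /=; last exact: in2W.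
by apply: eq_bigr => c _; rewrite fD1 ideal_imset IH.
Qed.

End Transfer.

(** * Young diagrams in a square grid *)

Definition cell N : finType := ('I_N * 'I_N)%type.
Definition gle N : rel (cell N) := fun c d => (c.1 <= d.1) && (c.2 <= d.2).

Lemma card_ord_lt N m : m <= N -> #|[set j : 'I_N | j < m]| = m.
Proof.
move=> leN; rewrite -sum1dep_card (big_ord_narrow leN) /= sum1_card; exact: card_ord.
Qed.

Lemma ord_downset N (A : {set 'I_N}) (j : 'I_N) :
  (forall i i' : 'I_N, i \in A -> i' <= i -> i' \in A) -> (j \in A) = (j < #|A|).
Proof.
move=> dA; apply/idP/idP => [jA|].
  rewrite -(card_ord_lt (ltn_ord j)); apply/subset_leq_card/subsetP => i.
  by rewrite inE ltnS; apply: dA.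
apply: contraTT => jA; rewrite -leqNgt -[leqRHS](card_ord_lt (ltnW (ltn_ord j))).
apply/subset_leq_card/subsetP => i iA; rewrite inE ltnNge.
by apply: contra jA => /(dA _ _ iA).
Qed.

Section Grid.
Variable N : nat.
Implicit Types (D M : {set cell N}) (c d : cell N).

(** The index is a natural number so that the row after the last one makes sense and has length
    0. *)
Definition rows D (i : nat) : nat := #|[set c in D | c.1 == i :> nat]|.

Lemma rowsE D (i : 'I_N) : rows D i = #|[set j : 'I_N | (i, j) \in D]|.
Proof.
rewrite -(@card_imset _ _ (fun j : 'I_N => (i, j))); last by move=> ? ? [].
apply: eq_card => -[i' j]; rewrite !inE /=; apply/andP/imsetP => [[cD /eqP/val_inj e]|].
  by exists j; rewrite ?inE -?e.
by case=> j'; rewrite inE => jD [-> ->].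
Qed.

Lemma in_rows D (i j : 'I_N) : ideal (@gle N) D -> ((i, j) \in D) = (j < rows D i).
Proof.
move=> /idealP iD; rewrite rowsE -ord_downset ?inE // => j1 j2; rewrite !inE => jD lej.
by apply: iD jD _; rewrite /gle /= leqnn.
Qed.

Lemma rows_out D i : N <= i -> rows D i = 0.
Proof.
move=> leNi; apply/eqP; rewrite cards_eq0 -subset0; apply/subsetP => c.
by rewrite !inE => /andP[_ /eqP ci]; have := ltn_ord c.1; rewrite ci; lia.
Qed.

Lemma rows_le D i : rows D i <= N.
Proof.
case: (ltnP i N) => [ltiN|/rows_out-> //].
by rewrite (rowsE D (Ordinal ltiN)) -[leqRHS]card_ord max_card.
Qed.

Lemma rows_anti D i i' : ideal (@gle N) D -> i <= i' -> rows D i' <= rows D i.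
Proof.
move=> iD lei; case: (ltnP i' N) => [lti'|/rows_out-> //].
have lti : i < N by lia.
rewrite leqNgt; apply/negP => ltr.
have ltj : rows D i < N by apply: leq_trans ltr (rows_le _ _).
have := in_rows (Ordinal lti') (Ordinal ltj) iD; rewrite /= ltr.
move/idealP: (iD) => /(_ _ (Ordinal lti, Ordinal ltj)) H /H.
by rewrite in_rows //= ltnn /gle /= lei leqnn => /(_ isT).
Qed.

Lemma sum_rows D : \sum_(i < N) rows D i = #|D|.
Proof.
rewrite -sum1_card (partition_big (fun c : cell N => c.1) predT) //=.
by apply: eq_bigr => i _; rewrite sum1dep_card; apply: eq_card => c; rewrite !inE.
Qed.

Lemma eq_rows D M : ideal (@gle N) D -> ideal (@gle N) M ->
  (forall i : 'I_N, rows D i = rows M i) -> D = M.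
Proof. by move=> iD iM e; apply/setP => -[i j]; rewrite !in_rows ?e. Qed.

End Grid.

(* The addable cells are one in row [0] and one in each row directly below the
   row of a removable cell. *)
Lemma addable_removable N (D : {set cell N}) : ideal (@gle N) D -> #|D| < N ->
  #|[set c | addable (@gle N) D c]| = #|[set c | removable (@gle N) D c]| + 1.
Proof.
case: N D => // n D iD ltDN; have /idealP iD' := iD.
(* With fewer than [n.+1] cells no row is full, so every row has a free cell, and the bottom row is
   empty, as otherwise all [n.+1] rows would be occupied. *)
have row_lt i : rows D i < n.+1.
  apply: leq_ltn_trans ltDN; apply/subset_leq_card/subsetP => c.
  by rewrite inE => /andP[].
have row_last : rows D n = 0.
  apply/eqP; rewrite -leqn0 leqNgt; apply/negP => rn.
  have : \sum_(i < n.+1) 1 <= \sum_(i < n.+1) rows D i.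
    apply: leq_sum => i _; apply: leq_trans rn _; apply: rows_anti => //.
    by rewrite -ltnS.
  by rewrite sum_rows sum1_card card_ord leqNgt ltDN.
have inordE (i : nat) : i < n.+1 -> val (inord i : 'I_n.+1) = i by exact: inordK.
have -> : [set c | addable (@gle n.+1) D c] =
    (fun i : 'I_n.+1 => (i, inord (rows D i) : 'I_n.+1)) @:
      [set i : 'I_n.+1 | (i == 0 :> nat) || (rows D i < rows D i.-1)].
  apply/setP => -[i j]; rewrite inE; apply/andP/imsetP.
    case; rewrite in_rows // -leqNgt => leij /idealP iDc.
    have leji : j <= rows D i.
      case: j leij iDc => -[|j] //= ltj leij iDc.
      have := iDc (i, Ordinal ltj) (i, Ordinal (ltnW ltj)) (setU11 _ _).
      rewrite /gle /= leqnn leqnSn => /(_ isT); rewrite !inE in_rows //=.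
      by case/orP => // /eqP[] /=; lia.
    have jE : j = rows D i :> nat by apply/eqP; rewrite eqn_leq leji.
    exists i; last by congr (_, _); apply: val_inj; rewrite inordE.
    rewrite inE; case: eqP => //= i0.
    have lti : i.-1 < n.+1 by have := ltn_ord i; lia.
    have := iDc (i, j) (Ordinal lti, j) (setU11 _ _).
    rewrite /gle /= leq_pred leqnn => /(_ isT); rewrite !inE in_rows //= jE.
    by case/orP => // /eqP[] /(congr1 val) /=; lia.
  case=> i'; rewrite inE => ci [-> ->] {i j}; split.
    by rewrite in_rows // inordE ?ltnn.
  apply/idealP => b [a1 a2] /setU1P[->|bD] ab; last first.
    by apply/setU1P; right; apply: iD' ab.
  move: ab; rewrite /gle /= inordE // => /andP[la1 la2].
  rewrite !inE; have [a1E|a1i] := eqVneq a1 i'.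
    rewrite a1E; case: (ltnP a2 (rows D i')) => lta; first by rewrite in_rows // lta orbT.
    apply/orP; left; apply/eqP; congr (_, _); apply: val_inj; rewrite inordE //; apply/eqP.
    by rewrite eqn_leq la2.
  have lta1 : a1 < i' by rewrite ltn_neqAle la1 andbT.
  rewrite in_rows //; apply/orP; right.
  case/orP: ci => [/eqP|lti]; first by lia.
  apply: leq_ltn_trans la2 (leq_trans lti _); apply: rows_anti => //; lia.
have -> : [set c | removable (@gle n.+1) D c] =
    (fun i : 'I_n.+1 => (i, inord (rows D i).-1 : 'I_n.+1)) @:
      [set i : 'I_n.+1 | rows D i.+1 < rows D i].
  apply/setP => -[i j]; rewrite inE; apply/andP/imsetP.
    case; rewrite in_rows // => ltji /idealP iDc.
    have leji : rows D i <= j.+1.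
      rewrite leqNgt; apply/negP => ltj.
      have ltj' : j.+1 < n.+1 by apply: ltn_trans ltj _.
      have := iDc (i, Ordinal ltj') (i, j).
      rewrite !inE in_rows //= ltj /gle /= leqnn leqnSn eqxx /= andbT => H.
      suff : false by []. apply: H => //; apply/eqP => -[] /(congr1 val) /=; lia.
    have jE : j = (rows D i).-1 :> nat by lia.
    exists i; last by congr (_, _); apply: val_inj; rewrite inordE // -jE.
    rewrite inE ltnNge; apply/negP => ler.
    case: (ltnP i.+1 n.+1) => lti; last by move: ler; rewrite (rows_out _ lti) leqNgt; case: (rows D i) ltji.
    have := iDc (Ordinal lti, j) (i, j).
    rewrite !inE in_rows //= /gle /= leqnn leqnSn eqxx /= => H.
    suff : false by []. apply: H => //; apply/andP; split; last by lia.
    by apply/eqP => -[] /(congr1 val) /=; lia.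
  case=> i'; rewrite inE => lti [-> ->] {i j}.
  have cE : val (inord (rows D i').-1 : 'I_n.+1) = (rows D i').-1.
    by rewrite inordE //; have := row_lt i'; lia.
  split; first by rewrite in_rows // cE; lia.
  apply/idealP => -[b1 b2] a /setD1P[bc bD] ab; apply/setD1P; split; last exact: iD' ab.
  apply/eqP => aE; move: ab bD; rewrite aE /gle in_rows //= cE => /andP[lb1 lb2] ltb.
  case/eqP: bc; have b1E : b1 = i'.
    apply/val_inj/eqP; rewrite eqn_leq lb1 andbT leqNgt; apply/negP => ltib.
    have := leq_trans (leq_ltn_trans lb2 ltb) (rows_anti iD ltib). rewrite /=; lia.
  rewrite b1E; congr (_, _); apply: val_inj; rewrite cE; move: ltb; rewrite b1E /=; lia.
rewrite !card_imset; last 2 first.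
- by move=> i i' [].
- by move=> i i' [].
(* Row 0 is split off on the left and the empty last row on the right; the remaining sums agree term
   by term, row [i.+1] against row [i]. *)
rewrite -!sum1dep_card [in LHS]big_mkcond [in RHS]big_mkcond /= big_ord_recl big_ord_recr /=.
rewrite row_last addn0 addnC; congr (_ + _).
Qed.

(** * Partitions and skew tableaux *)

Lemma geq_trans : transitive geq.
Proof. by move=> y x z /= xy yz; apply: leq_trans yz xy. Qed.

(** The zeros of a nonincreasing sequence form its tail, where the default value of [nth] replaces
    them. *)
Lemma nth_filter_pos s i : sorted geq s -> nth 0 [seq x <- s | 0 < x] i = nth 0 s i.
Proof.
elim: s i => //= x s IH i ps; have ss := path_sorted ps.
case: x ps => [|x] ps /=; last by case: i => //= i; apply: IH.
have /allP s0 := order_path_min geq_trans ps.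
have -> : [seq x <- s | 0 < x] = [::].
  by apply/eqP; rewrite -[_ == _]negbK -has_filter; apply/hasPn => y /s0 /=; lia.
case: i => // i; rewrite nth_nil; case: (ltnP i (size s)) => [lti|gei].
  by have := s0 _ (mem_nth 0 lti); rewrite /=; lia.
by rewrite /= nth_default.
Qed.

Lemma sumn_filter_pos s : sumn [seq x <- s | 0 < x] = sumn s.
Proof. by elim: s => //= -[|x] s IH /=; rewrite IH. Qed.

Lemma is_partition_filter_pos s : sorted geq s -> is_partition [seq x <- s | 0 < x].
Proof.
move=> ss; rewrite /is_partition sorted_filter //; last exact: geq_trans.
by apply/allP => x; rewrite mem_filter => /andP[].
Qed.

Lemma nth_partition_anti l i j : is_partition l -> i <= j -> nth 0 l j <= nth 0 l i.
Proof.
move=> /andP[sl _] leij; case: (ltnP j (size l)) => ltj; last by rewrite nth_default.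
apply: (sorted_leq_nth geq_trans _ 0 sl i j) => //; rewrite ?inE //; first by move=> x /=.
exact: leq_ltn_trans ltj.
Qed.

Lemma size_partition l : is_partition l -> size l <= sumn l.
Proof.
move=> /andP[_]; elim: l => //= x l IH /andP[x0 /IH]; lia.
Qed.

Lemma nth_le_sumn l i : nth 0 l i <= sumn l.
Proof.
elim: l i => [|x l IH] [|i] //=; first by lia.
by have := IH i; lia.
Qed.

Lemma sumn_nth l N : size l <= N -> \sum_(i < N) nth 0 l i = sumn l.
Proof.
move=> leN; rewrite sumnE (big_nth 0) big_mkord.
rewrite -(big_mkord xpredT (nth 0 l)) (big_cat_nat (leq0n _) leN) /= big_mkord.
suff -> : \sum_(size l <= i < N) nth 0 l i = 0 by rewrite addn0.
by rewrite big_nat_cond big1 // => i /andP[/andP[lei _] _]; rewrite nth_default.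
Qed.

Section Cells.
Variable N : nat.

Definition cells (l : seq nat) : {set cell N} := [set c : cell N | inS l c.1 c.2].

Lemma cells_ideal l : is_partition l -> ideal (@gle N) (cells l).
Proof.
move=> pl; apply/idealP => c d; rewrite !inE /inS /gle => ltc /andP[le1 le2].
apply: leq_ltn_trans le2 (leq_trans ltc _); exact: nth_partition_anti.
Qed.

Lemma rows_cells l i : is_partition l -> sumn l <= N -> rows (cells l) i = nth 0 l i.
Proof.
move=> pl leN; case: (ltnP i N) => [ltiN|leNi].
  rewrite (rowsE _ (Ordinal ltiN)) -[RHS](@card_ord_lt N).
    by apply: eq_card => j; rewrite !inE.
  exact: leq_trans (nth_le_sumn _ _) leN.
rewrite rows_out // nth_default //.
by apply: leq_trans (size_partition pl) (leq_trans leN leNi).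
Qed.

Lemma card_cells l : is_partition l -> sumn l <= N -> #|cells l| = sumn l.
Proof.
move=> pl leN; rewrite -sum_rows -(@sumn_nth l N).
  by apply: eq_bigr => i _; rewrite rows_cells.
exact: leq_trans (size_partition pl) leN.
Qed.

Lemma rows_sorted (D : {set cell N}) : ideal (@gle N) D -> sorted geq (mkseq (rows D) N).
Proof.
move=> iD; apply/(sortedP 0) => i; rewrite size_mkseq => lti.
by rewrite nth_mkseq 1?ltnW // nth_mkseq //; exact: rows_anti (leqnSn i).
Qed.

Lemma nth_rows (D : {set cell N}) i : ideal (@gle N) D ->
  nth 0 [seq x <- mkseq (rows D) N | 0 < x] i = rows D i.
Proof.
move=> iD; rewrite nth_filter_pos ?rows_sorted //.
case: (ltnP i N) => lti; first by rewrite nth_mkseq.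
by rewrite nth_default ?size_mkseq // rows_out.
Qed.

Lemma cells_rows (D : {set cell N}) : ideal (@gle N) D ->
  cells [seq x <- mkseq (rows D) N | 0 < x] = D.
Proof.
by move=> iD; apply/setP => -[i j]; rewrite inE /inS nth_rows // in_rows.
Qed.

Lemma sumn_rows (D : {set cell N}) :
  sumn [seq x <- mkseq (rows D) N | 0 < x] = #|D|.
Proof.
rewrite sumn_filter_pos sumnE big_map -sum_rows.
by rewrite -(big_mkord xpredT (rows D)) /index_iota subn0.
Qed.

Lemma rows_eq0 (D : {set cell N}) i : ideal (@gle N) D -> #|D| <= i -> rows D i = 0.
Proof.
move=> iD leDi; rewrite -nth_rows // nth_default //.
apply: leq_trans leDi; rewrite -sumn_rows size_partition //.
exact: is_partition_filter_pos (rows_sorted iD).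
Qed.

(* A strictly increasing filling along rows and columns is a linear extension:
   two comparable cells of a skew shape are joined through the corner
   [(c.1, d.2)], which also lies in the shape. *)
Lemma skew_sytE lam mu (S : {ffun cell N -> 'I_N.+1}) :
  ideal (@gle N) (cells lam) -> ideal (@gle N) (cells mu) ->
  cells mu \subset cells lam ->
  skew_syt lam mu S =
  (S \in fillings (@gle N) [ffun=> ord0] (cells mu) 0 (sumn lam - sumn mu) (cells lam)).
Proof.
move=> /idealP iD /idealP iM sMD.
have skE i j : skew lam mu (i : 'I_N) (j : 'I_N) = ((i, j) \in cells lam :\: cells mu).
  by rewrite !inE andbC.
apply/and5P/fillingsP => -[h1 h2 h3 h4 h5].
  have S0 c : (S c != 0 :> nat) = (c \in cells lam :\: cells mu).
    case: c => i j; rewrite -skE; by have /eqP := forallP (forallP h1 i) j.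
  split.
  - move=> c cM; rewrite ffunE; apply/val_inj/eqP; rewrite -[_ == _]negbK S0.
    by rewrite inE cM.
  - move=> c cD; apply/val_inj/eqP; rewrite -[_ == _]negbK S0.
    by rewrite inE (negPf cD) andbF.
  - move=> [i j] cDM; rewrite lt0n S0 cDM /= add0n.
    by apply: (implyP (forallP (forallP h2 i) j)); rewrite skE.
  - move=> [i j] [i' j'] cDM dDM Sij.
    have /implyP := forallP (forallP (forallP (forallP h3 i) j) i') j'.
    by rewrite !skE cDM dDM Sij eqxx => /(_ isT)/andP[/eqP-> /eqP->].
  - have row i j j' : (i, j) \in cells lam :\: cells mu ->
      (i, j') \in cells lam :\: cells mu -> j < j' -> S (i, j) < S (i, j').
      move=> cDM dDM lt; apply: (implyP (forallP (forallP (forallP h4 i) j) j')).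
      by rewrite !skE cDM dDM lt.
    have col i i' j : (i, j) \in cells lam :\: cells mu ->
      (i', j) \in cells lam :\: cells mu -> i < i' -> S (i, j) < S (i', j).
      move=> cDM dDM lt; apply: (implyP (forallP (forallP (forallP h5 i) i') j)).
      by rewrite !skE cDM dDM lt.
    move=> [i j] [i' j'] cDM dDM /andP[/= lei lej] ne.
    have eDM : (i, j') \in cells lam :\: cells mu.
      apply/setDP; split.
        by case/setDP: dDM => dD _; apply: iD dD _; rewrite /gle /= lei leqnn.
      case/setDP: cDM => _; apply: contra => eM; apply: iM eM _.
      by rewrite /gle /= lej leqnn.
    have [/val_inj ji|] := eqVneq (j : nat) j'.
      subst j'; apply: col => //; rewrite ltn_neqAle lei andbT.
      by apply: contraNneq ne => /val_inj ->.
    move=> nj; have ltj : j < j' by rewrite ltn_neqAle nj.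
    have := row _ _ _ cDM eDM ltj.
    have [/val_inj ii|ni] := eqVneq (i : nat) i'; first by rewrite ii.
    by move/ltn_trans; apply; apply: col => //; rewrite ltn_neqAle ni.
split.
- apply/forallP => i; apply/forallP => j; rewrite skE; apply/eqP.
  case: (boolP ((i, j) \in cells lam :\: cells mu)) => cDM.
    by have /andP[] := h3 _ cDM; rewrite lt0n.
  move: cDM; rewrite inE negb_and negbK => /orP[/h1->|/h2-> //].
  by rewrite ffunE.
- apply/forallP => i; apply/forallP => j; rewrite skE; apply/implyP => /h3.
  by case/andP.
- do 4![apply/forallP => ?]; rewrite !skE; apply/implyP => /and3P[cDM dDM /eqP/val_inj].
  by move/(h4 _ _ cDM dDM) => [-> ->]; rewrite !eqxx.
- do 3![apply/forallP => ?]; rewrite !skE; apply/implyP => /and3P[cDM dDM lt].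
  apply: h5 => //; first by rewrite /gle /= leqnn ltnW.
  by apply: contraTneq lt => -[->]; rewrite ltnn.
- do 3![apply/forallP => ?]; rewrite !skE; apply/implyP => /and3P[cDM dDM lt].
  apply: h5 => //; first by rewrite /gle /= leqnn ltnW.
  by apply: contraTneq lt => -[->]; rewrite ltnn.
Qed.

End Cells.

Lemma subpartE N mu lam : is_partition mu -> sumn mu <= N ->
  subpart mu lam = (cells N mu \subset cells N lam).
Proof.
move=> pmu leN; apply/allP/subsetP => [sub c|sub i].
  rewrite !inE /inS => ltc; apply: leq_trans (ltc) (sub _ _).
  rewrite mem_iota /= add0n ltnNge; apply: contraTN ltc => ge.
  by rewrite nth_default.
rewrite mem_iota /= add0n => lti; rewrite leqNgt; apply/negP => ltn.
have ltiN : i < N by apply: leq_trans lti (leq_trans (size_partition pmu) leN).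
have ltjN : nth 0 lam i < N.
  by apply: leq_trans ltn (leq_trans (nth_le_sumn _ _) leN).
(* The witness is the first cell of row [i] outside [lam], which lies in [mu]. *)
have := sub (Ordinal ltiN, Ordinal ltjN).
by rewrite !inE /inS /= ltnn ltn => /(_ isT).
Qed.

Lemma fskewE lam mu : is_partition lam -> is_partition mu -> sumn mu <= sumn lam ->
  fskew lam mu =
  chains (@gle (sumn lam)) (cells _ mu) (sumn lam - sumn mu) (cells _ lam).
Proof.
move=> plam pmu lemu; rewrite /fskew (subpartE _ pmu lemu).
case: ifPn => sub; last by rewrite chains_eq0 // (negPf sub).
rewrite -(@card_fillings _ _ (sumn lam) [ffun=> ord0] _ 0) ?cells_ideal //; last 2 first.
- by rewrite !card_cells // subnKC.
- by rewrite add0n leq_subr.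
by apply: eq_card => S; rewrite inE skew_sytE ?cells_ideal.
Qed.

(** * Partitions of j as down-closed sets of j cells *)

Section FFPart.
Variables (k j : nat).
Hypothesis lejk : j <= k.

Lemma ffpartE (mu : {ffun 'I_j -> 'I_j.+1}) : is_ffpart mu ->
  [/\ is_partition (ffpart mu), sumn (ffpart mu) = j
    & forall i : 'I_j, nth 0 (ffpart mu) i = mu i].
Proof.
move=> /andP[/forallP an /eqP sum].
have nthE (i : 'I_j) : nth 0 [seq val (mu i) | i <- enum 'I_j] i = mu i.
  by rewrite (nth_map i) ?size_enum_ord // nth_ord_enum.
have smu : sorted geq [seq val (mu i) | i <- enum 'I_j].
  apply/(sortedP 0) => i; rewrite size_map size_enum_ord => lti.
  rewrite (nthE (Ordinal lti)) (nthE (Ordinal (ltnW lti))).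
  by apply: (implyP (forallP (an _) _)) => /=.
split; first exact: is_partition_filter_pos.
  by rewrite sumn_filter_pos sumnE big_map big_enum.
by move=> i; rewrite nth_filter_pos.
Qed.

(** Taking row lengths, as in [h'], inverts taking cells. The first [j] rows suffice, since a
    diagram with [j] cells has at most [j] nonempty rows, and [j <= k] makes every partition of [j]
    fit in the grid. *)
Lemma sum_ffpart (F : {set cell k} -> nat) :
  \sum_(mu : {ffun 'I_j -> 'I_j.+1} | is_ffpart mu) F (cells k (ffpart mu))
  = \sum_(M | ideal (@gle k) M && (#|M| == j)) F M.
Proof.
pose h' (M : {set cell k}) : {ffun 'I_j -> 'I_j.+1} := [ffun i : 'I_j => inord (rows M i)].
have h'E (M : {set cell k}) i : #|M| = j -> val (h' M i) = rows M i.
  move=> cM; rewrite ffunE /= inordK // ltnS -[leqRHS]cM.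
  by apply/subset_leq_card/subsetP => c; rewrite inE => /andP[].
have h'P (M : {set cell k}) : ideal (@gle k) M -> #|M| = j -> is_ffpart (h' M).
  move=> iM cM; apply/andP; split.
    apply/forallP => a; apply/forallP => b; apply/implyP => leab.
    by rewrite !h'E //; apply: rows_anti.
  have [pr sr] := (is_partition_filter_pos (rows_sorted iM), sumn_rows M).
  rewrite -[X in _ == X]cM -sr -(@sumn_nth _ j); last by rewrite -[leqRHS]cM -sr size_partition.
  by apply/eqP/eq_bigr => i _; rewrite h'E // nth_rows.
rewrite [RHS](reindex_onto (fun mu => cells k (ffpart mu)) h') /=; last first.
  move=> M /andP[iM /eqP cM]; have /ffpartE[p s n] := h'P M iM cM.
  apply: eq_rows => // [|i]; first exact: cells_ideal.
  rewrite rows_cells // ?s //; case: (ltnP i j) => [ltij|leji].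
    by rewrite (n (Ordinal ltij)) h'E.
  by rewrite rows_eq0 ?cM // nth_default // (leq_trans (size_partition p)) ?s.
apply: eq_bigl => mu; apply/idP/andP.
  move=> fmu; have [p s n] := ffpartE fmu; split.
    by rewrite cells_ideal // card_cells ?s ?eqxx.
  apply/eqP/ffunP => i; apply: val_inj; rewrite h'E ?rows_cells ?n ?s //.
  by rewrite card_cells ?s.
by case=> /andP[iM /eqP cM] /eqP <-; apply: h'P.
Qed.
End FFPart.

(** * Tableaux containing a given tableau *)

Lemma inS_fit lam i j : is_partition lam -> inS lam i j ->
  (i < sumn lam) && (j < sumn lam).
Proof.
move=> pl lt; rewrite (leq_trans lt (nth_le_sumn _ _)) andbT.
apply: leq_trans (size_partition pl); rewrite ltnNge; apply: contraTN lt => le.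
by rewrite /inS nth_default.
Qed.

Definition widen_cell k n (le_kn : k <= n) (c : cell k) : cell n :=
  (widen_ord le_kn c.1, widen_ord le_kn c.2).

Lemma widen_cells lam n (le_kn : sumn lam <= n) : is_partition lam ->
  widen_cell le_kn @: cells _ lam = cells _ lam.
Proof.
move=> pl; apply/setP => -[i j]; apply/imsetP/idP.
  by case=> -[i' j']; rewrite !inE /inS /= => lt [-> ->].
rewrite inE /= => lt; have /andP[lti ltj] := inS_fit pl lt.
exists (Ordinal lti, Ordinal ltj); first by rewrite inE.
by congr (_, _); apply: val_inj.
Qed.

(** The tableaux containing [T] live in the grid of side [n], whereas [fskew] counts in the grid of
    side [sumn lam]; this reconciles the two. *)
Lemma down_chains_widen lam n i : is_partition lam -> sumn lam <= n ->
  down_chains (@gle n) i (cells n lam) = down_chains (@gle _) i (cells (sumn lam) lam).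
Proof.
move=> pl le_kn; rewrite -(widen_cells le_kn pl); apply: down_chains_imset.
- by move=> [a b] [a' b'] [/val_inj-> /val_inj->].
- by [].
move=> [a b] [c d] /andP[/= lec led]; apply/codomP.
have ltc : c < sumn lam by apply: leq_ltn_trans lec (ltn_ord a).
have ltd : d < sumn lam by apply: leq_ltn_trans led (ltn_ord b).
by exists (Ordinal ltc, Ordinal ltd); congr (_, _); apply: val_inj.
Qed.

Section Ext.
Variables (lam : seq nat) (T : {ffun cell (sumn lam) -> 'I_(sumn lam).+1}).
Hypotheses (plam : is_partition lam) (Tsyt : skew_syt lam [::] T).
Local Notation k := (sumn lam).

Lemma extE (i j : 'I_k) : ext T i j = T (i, j).
Proof. by rewrite /ext !valK. Qed.

Lemma T_fillings : T \in fillings (@gle k) [ffun=> ord0] set0 0 k (cells k lam).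
Proof.
have c0 : cells k [::] = set0 by apply/setP => c; rewrite !inE /inS nth_nil.
have i0 : ideal (@gle k) (cells k [::]) by apply: cells_ideal.
by move: Tsyt; rewrite skew_sytE ?cells_ideal ?c0 ?sub0set // subn0.
Qed.

Lemma ext_neq0 i j : (ext T i j != 0) = inS lam i j.
Proof.
have /fillingsP[_ T0 T1 _ _] := T_fillings.
case: (ltnP i k) => [lti|lei]; last first.
  rewrite /ext insubF ?ltnNge ?lei //; apply/esym/negP => /(inS_fit plam)/andP[].
  by rewrite ltnNge lei.
case: (ltnP j k) => [ltj|lej]; last first.
  rewrite /ext [insub j]insubF ?ltnNge ?lej //.
  have -> : inS lam i j = false.
    by apply/negP => /(inS_fit plam)/andP[_]; rewrite ltnNge lej.
  by case: insub.
rewrite (extE (Ordinal lti) (Ordinal ltj)).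
have [cD|cD] := boolP ((Ordinal lti, Ordinal ltj) \in cells k lam).
  have := T1 (Ordinal lti, Ordinal ltj); rewrite setD0 cD => /(_ isT)/andP[].
  by move: cD; rewrite inE lt0n => -> ->.
by rewrite T0 //; move: cD; rewrite inE => /negPf ->.
Qed.

Lemma ext_le i j : ext T i j <= k.
Proof. by rewrite /ext; case: insub => // a; case: insub => // b; rewrite -ltnS ltn_ord. Qed.

Lemma ext_inj i j i' j' : inS lam i j -> inS lam i' j' ->
  ext T i j = ext T i' j' -> i = i' /\ j = j'.
Proof.
move=> s s'; have /andP[lti ltj] := inS_fit plam s.
have /andP[lti' ltj'] := inS_fit plam s'.
rewrite (extE (Ordinal lti) (Ordinal ltj)) (extE (Ordinal lti') (Ordinal ltj')).
have /fillingsP[_ _ _ Tinj _] := T_fillings.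
by move=> /val_inj/Tinj; rewrite setD0 !inE /= => /(_ s s') [-> ->].
Qed.

Lemma ext_mono i j i' j' : inS lam i j -> inS lam i' j' ->
  i <= i' -> j <= j' -> (i != i') || (j != j') -> ext T i j < ext T i' j'.
Proof.
move=> s s' lei lej ne; have /andP[lti ltj] := inS_fit plam s.
have /andP[lti' ltj'] := inS_fit plam s'.
rewrite (extE (Ordinal lti) (Ordinal ltj)) (extE (Ordinal lti') (Ordinal ltj')).
have /fillingsP[_ _ _ _ Tm] := T_fillings.
apply: Tm; rewrite ?setD0 ?inE //; first by rewrite /gle lei lej.
by apply: contraTneq ne => -[-> ->]; rewrite !eqxx.
Qed.

Variable n : nat.
Hypothesis le_kn : k <= n.

Let M : {set cell n} := cells n lam.
Let B : {ffun cell n -> 'I_n.+1} := [ffun c : cell n => inord (ext T c.1 c.2)].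

Definition support (S : {ffun cell n -> 'I_n.+1}) : {set cell n} :=
  [set c | S c != 0 :> nat].

Lemma BE c : B c = ext T c.1 c.2 :> nat.
Proof. by rewrite ffunE inordK // ltnS (leq_trans (ext_le _ _)). Qed.

Lemma shape_of_support S : shape_of S = [seq x <- mkseq (rows (support S)) n | 0 < x].
Proof.
rewrite /shape_of /mkseq -val_enum_ord -map_comp; congr filter; apply: eq_map => i /=.
by rewrite rowsE; apply: eq_card => j; rewrite !inE.
Qed.

Lemma syt_fillings S : is_syt S ->
  [/\ ideal (@gle n) (support S), #|support S| = n &
      S \in fillings (@gle n) [ffun=> ord0] set0 0 n (support S)].
Proof.
case/and3P=> pS /eqP sS skS.
have SE : support S = cells n (shape_of S).
  apply/setP => -[i j]; rewrite inE.
  case/and5P: skS => /forallP/(_ i)/forallP/(_ j)/eqP h _ _ _ _.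
  by rewrite h inE /skew /inS nth_nil andbT.
have iS : ideal (@gle n) (support S) by rewrite SE cells_ideal.
have c0 : cells n [::] = set0 by apply/setP => c; rewrite !inE /inS nth_nil.
have i0 : ideal (@gle n) set0 by rewrite -c0 cells_ideal.
split=> //; first by rewrite SE card_cells // sS.
by move: skS; rewrite skew_sytE -?SE ?c0 ?sub0set // sS subn0.
Qed.

Lemma fillings_syt S D : ideal (@gle n) D -> #|D| = n ->
  S \in fillings (@gle n) [ffun=> ord0] set0 0 n D -> support S = D /\ is_syt S.
Proof.
move=> iD cD SF; have /fillingsP[_ S0 S1 _ _] := SF.
have SD : support S = D.
  apply/setP => c; rewrite inE; case: (boolP (c \in D)) => cD'.
    by have := S1 c; rewrite setD0 => /(_ cD')/andP[]; rewrite lt0n.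
  by rewrite S0.
split=> //; rewrite /is_syt shape_of_support SD.
have c0 : cells n [::] = set0 by apply/setP => c; rewrite !inE /inS nth_nil.
have i0 : ideal (@gle n) set0 by rewrite -c0 cells_ideal.
rewrite is_partition_filter_pos ?rows_sorted // sumn_rows cD eqxx /=.
by rewrite skew_sytE ?cells_rows ?c0 ?sub0set // sumn_rows cD subn0.
Qed.

(** Once the shape [D] is fixed, a tableau containing [T] is [T] on [M] together with a linear
    extension of [D :\: M] labelled from [k + 1] to [n]. *)
Lemma syt_containsP S D : ideal (@gle n) D ->
  (is_syt S && contains T S && (support S == D)) =
  [&& M \subset D, #|D| == n & S \in fillings (@gle n) B M k (n - k) D].
Proof.
move=> iD; have iM : ideal (@gle n) M by apply: cells_ideal.
have ME c : (c \in M) = (ext T c.1 c.2 != 0) by rewrite ext_neq0 inE.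
apply/idP/and3P.
  case/andP=> /andP[/syt_fillings[_ cS SF] /forallP cont] /eqP SD.
  rewrite {}SD in cS SF; have /fillingsP[_ S0 S1 S2 S3] := SF.
  have contE c : if S c <= k then S c = ext T c.1 c.2 :> nat else ext T c.1 c.2 = 0.
    case: c => i j; have := forallP (cont i) j; rewrite /=.
    by case: ifP => _ /eqP.
  have sMD : M \subset D.
    apply/subsetP => c; rewrite ME; apply: contraR => /S0 Sc.
    by have := contE c; rewrite Sc /= => <-.
  split=> //; first by rewrite cS.
  rewrite setD0 in S1 S2 S3; apply/fillingsP; split.
  - move=> c cM; apply: val_inj; rewrite /= BE; have := contE c.
    by case: ifP => // _ e; move: cM; rewrite ME e.
  - exact: S0.
  - move=> c /setDP[cD cM]; apply/andP; split; last by rewrite subnKC // -ltnS ltn_ord.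
    (* A label at most [k] would be a nonzero entry of [T], which puts its cell in [M]. *)
    rewrite ltnNge; apply/negP => leS; have := contE c; rewrite leS => e.
    by move: (S1 c cD) cM; rewrite ME -e negbK lt0n => /andP[/negPf ->].
  - by move=> c d /setDP[cD _] /setDP[dD _]; apply: S2.
  - by move=> c d /setDP[cD _] /setDP[dD _]; apply: S3.
case=> sMD /eqP cD /fillingsP[S1 S2 S3 S4 S5].
have inDM c : c \in D -> c \notin M -> c \in D :\: M by move=> cD' cM; rewrite inE cM.
have SM c : c \in M -> S c = ext T c.1 c.2 :> nat by move=> cM; rewrite S1 // BE.
have Sle c : c \in M -> S c <= k by move=> cM; rewrite SM // ext_le.
have Sgt c : c \in D -> c \notin M -> k < S c.
  by move=> cD' cM; case/andP: (S3 c (inDM c cD' cM)).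
(* Labels are at most [k] on [M] and exceed [k] on the rest of [D]. This settles every comparison
   between the two parts, and no cell outside [M] lies below one of [M]. *)
have SF : S \in fillings (@gle n) [ffun=> ord0] set0 0 n D.
  apply/fillingsP; split.
  - by move=> c; rewrite inE.
  - exact: S2.
  - move=> c; rewrite setD0 => cD'; apply/andP; split; last by rewrite -ltnS ltn_ord.
    case: (boolP (c \in M)) => cM; first by rewrite SM // lt0n -ME.
    exact: leq_ltn_trans (Sgt c cD' cM).
  - move=> c d; rewrite setD0 => cD' dD' Scd.
    case: (boolP (c \in M)) => cM; case: (boolP (d \in M)) => dM.
    + move: (cM) (dM); rewrite !inE => sc sd.
      have := congr1 val Scd; rewrite /= !SM // => /(ext_inj sc sd).
      by case: c d {cD' dD' Scd cM dM sc sd} => i j [i' j'] /= [/val_inj-> /val_inj->].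
    + by have := Sle c cM; rewrite Scd leqNgt Sgt.
    + by have := Sle d dM; rewrite -Scd leqNgt Sgt.
    by apply: S4 => //; apply: inDM.
  - move=> c d; rewrite setD0 => cD' dD' cd ncd.
    case: (boolP (d \in M)) => dM.
      have cM : c \in M by move/idealP: iM => /(_ _ _ dM cd).
      move: (cM) (dM); rewrite !inE => sc sd; rewrite !SM //.
      case/andP: cd => l1 l2; apply: ext_mono => //.
      by rewrite -negb_and; apply: contra ncd => /andP[/eqP/val_inj e1 /eqP/val_inj e2];
        rewrite -pair_eqE /= /pair_eq e1 e2 !eqxx.
    case: (boolP (c \in M)) => cM.
      exact: leq_ltn_trans (Sle c cM) (Sgt d dD' dM).
    by apply: S5 => //; apply: inDM.
have [-> ->] := fillings_syt iD cD SF; rewrite eqxx andbT /=.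
apply/forallP => i; apply/forallP => j.
case: (boolP ((i, j) \in M)) => cM; first by rewrite /= Sle // SM.
have := cM; rewrite ME negbK /= => /eqP ->; rewrite eqxx.
case: (boolP ((i, j) \in D)) => cD'; first by rewrite leqNgt Sgt.
by rewrite S2.
Qed.

(** Tableaux are sorted by their shape; shapes of the wrong size, or not containing [M], contribute
    0 to both sides. *)
Lemma card_syt_contains :
  #|[set S : {ffun cell n -> 'I_n.+1} | is_syt S && contains T S]|
  = up_chains (@gle n) (n - k) M.
Proof.
have iM : ideal (@gle n) M by apply: cells_ideal.
have cM : #|M| = k by apply: card_cells.
rewrite up_chainsE // -sum1dep_card.
rewrite (partition_big support (ideal (@gle n))) /=; last first.
  by move=> S /andP[/syt_fillings[]].
apply: eq_bigr => D iD.
have [/andP[sMD /eqP cD]|nD] := boolP ((M \subset D) && (#|D| == #|M| + (n - k))).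
  rewrite -(@card_fillings _ _ n B _ k) ?subnKC // -sum1_card.
  by apply: eq_bigl => S; rewrite syt_containsP // sMD cD cM subnKC ?eqxx.
rewrite chains_eq0 // big_pred0 // => S; rewrite syt_containsP //.
by apply: contraNF nD => /and3P[-> cD _]; rewrite cM subnKC.
Qed.

End Ext.

Theorem mainTheorem15 (k : nat) (lam : seq nat)
  (T : {ffun 'I_k * 'I_k -> 'I_k.+1}) (n : nat) :
  is_partition lam -> sumn lam = k -> skew_syt lam [::] T -> k <= n ->
  #|[set S : {ffun 'I_n * 'I_n -> 'I_n.+1} | is_syt S && contains T S]| =
  \sum_(j < k.+1) \sum_(mu : {ffun 'I_j -> 'I_j.+1} | is_ffpart mu)
     fskew lam (ffpart mu) * 'C(n - k, k - j) * tinv ((n - k) - (k - j)).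
Proof.
move=> plam lamk; case: k / lamk T => T Tsyt le_kn.
have iM : ideal (@gle n) (cells n lam) by apply: cells_ideal.
have cM : #|cells n lam| = sumn lam by apply: card_cells.
(* The bound [n.+1] exceeds both n - k and k, so the range can next be cut down to i <= k: at most k
   cells can be removed from [lam]. *)
rewrite (card_syt_contains plam Tsyt le_kn) (@up_chains_down_chains _ _ _ _ n.+1) //; last 2 first.
- by move=> D iD; rewrite cM subnKC // => ltD; apply: addable_removable.
- by rewrite ltnS leq_subr.
transitivity (\sum_(i < (sumn lam).+1) 'C(n - sumn lam, i) * tinv (n - sumn lam - i)
    * down_chains (@gle n) i (cells n lam)).
  rewrite [RHS](big_ord_widen n.+1 (fun i => 'C(n - sumn lam, i) *
    tinv (n - sumn lam - i) * down_chains (@gle n) i (cells n lam))) // [RHS]big_mkcond.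
  apply: eq_bigr => i _; case: ifPn => // lti.
  by rewrite down_chains_eq0 ?muln0 // cM; move: lti; rewrite -ltnNge.
(* The substitution i = k - j passes from the number of removed cells to the size of the remaining
   partition. *)
rewrite (reindex_inj rev_ord_inj) /=; apply: eq_bigr => j _; rewrite subSS.
have lej : j <= sumn lam by rewrite -ltnS.
rewrite -big_distrl /= -big_distrl /= mulnC mulnA; congr (_ * _ * _).
rewrite down_chains_widen // down_chainsE ?cells_ideal //.
(* Chains with k - j steps starting at [lam] end only at ideals with j cells. *)
transitivity (\sum_(M | ideal (@gle (sumn lam)) M && (#|M| == j))
    chains (@gle (sumn lam)) M (sumn lam - j) (cells (sumn lam) lam)).
  rewrite [RHS]big_mkcondr; apply: eq_bigr => M _; case: ifPn => // cMj.
  rewrite chains_eq0 // negb_and card_cells //; apply/orP; right.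
  by apply: contra cMj => /eqP; lia.
rewrite -sum_ffpart //; apply: eq_bigr => mu /ffpartE[p s _].
by rewrite fskewE ?s.
Qed.
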